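(* For any increasing range map $\delta$ and any $n\geq0$, the map $\mathbf{e}_{\mathsf{Hi}_\delta}^{-1}\circ\mathbf{e}_{\mathsf{Ca}_\delta}$ from $\mathsf{Ca}_\delta(n)$ to $\mathsf{Hi}_\delta(n)$ is a poset morphism (i.e. order preserving).
   Context: $\mathbb{N}=\{0,1,2,\dots\}$. A range map is a map $\delta:\mathbb{N}\setminus\{0\}\to\mathbb{N}$; it is increasing if $\delta(i)<\delta(i+1)$ for all $i\geq1$. A $\delta$-cliff of size $n$ is a word $u=u_1\cdots u_n$ of nonnegative integers with $u_i\leq\delta(i)$ for all $i$; $\mathsf{Cl}_\delta(n)$ is the set of them, ordered componentwise: $u\preccurlyeq v$ iff $u_i\leq v_i$ for all $i$. All subsets carry the induced order. $\mathsf{Hi}_\delta(n)$ is the set of $\delta$-cliffs $u$ of size $n$ ($\delta$-hills) with $u_i\leq u_{i+1}$ for all $1\leq i\leq n-1$. $\mathsf{Ca}_\delta(n)$ is the set of $\delta$-cliffs $u$ of size $n$ ($\delta$-canyons) such that $u_{i-j}\leq u_i-j$ for all $i\in\{1,\dots,n\}$ and all $j\in\{1,\dots,u_i\}$ with $i-j\geq1$. Let $\mathcal{S}=\bigsqcup_n\mathcal{S}(n)$ be a set of $\delta$-cliffs graded by size and closed under taking prefixes (both $\mathsf{Hi}_\delta$ and $\mathsf{Ca}_\delta$ are). For $u\in\mathcal{S}(k)$ let $\mathrm{F}_{\mathcal{S}}(u):=\{a\in\{0,\dots,\delta(k+1)\}:ua\in\mathcal{S}\}$. The $\mathcal{S}$-elevation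 map $\mathbf{e}_{\mathcal{S}}:\mathcal{S}(n)\to\mathsf{Cl}_\delta(n)$ is defined by $\mathbf{e}_{\mathcal{S}}(u)_i:=\#\{a\in\mathrm{F}_{\mathcal{S}}(u_1\cdots u_{i-1}):a<u_i\}$ for all $1\leq i\leq n$. This map is injective on $\mathcal{S}(n)$, and $\mathbf{e}_{\mathcal{S}}^{-1}$ denotes its inverse, defined on its image. For increasing $\delta$, the maps $\mathbf{e}_{\mathsf{Hi}_\delta}$ on $\mathsf{Hi}_\delta(n)$ and $\mathbf{e}_{\mathsf{Ca}_\delta}$ on $\mathsf{Ca}_\delta(n)$ have the same image, so that the composition in the claim is well defined. *)

(* Defs.v *)
From mathcomp Require Import all_boot.
From mathcomp Require Import boolp classical_sets functions.

Set Implicit Arguments.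
Unset Strict Implicit.
Unset Printing Implicit Defensive.

Local Open Scope classical_set_scope.

(* Letters are numbered from 1; only indices 1 <= i <= size u are meaningful. *)
Definition letter (u : seq nat) (i : nat) : nat := nth 0 u i.-1.

(* A range map is represented by a function on nat whose value at 0 is never
   used. *)
Definition increasing_range_map (delta : nat -> nat) : Prop :=
  forall i : nat, 1 <= i -> delta i < delta i.+1.

Definition cliff (delta : nat -> nat) (u : seq nat) : bool :=
  all (fun i => letter u i <= delta i) (iota 1 (size u)).

Definition hill (delta : nat -> nat) (u : seq nat) : bool :=
  cliff delta u &&
  all (fun i => letter u i <= letter u i.+1) (iota 1 (size u).-1).

(* The inner test ranges over 1 <= j <= u_i, so neither subtraction is
   truncated when 1 <= i - j. *)
Definition canyon (delta : nat -> nat) (u : seq nat) : bool :=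
  cliff delta u &&
  all (fun i =>
         all (fun j => (1 <= i - j) ==> (letter u (i - j) <= letter u i - j))
             (iota 1 (letter u i)))
      (iota 1 (size u)).

Definition graded (S : pred (seq nat)) (n : nat) : set (seq nat) :=
  [set u | size u = n /\ S u].

(* [all2] also requires equal sizes. *)
Definition cliff_le (u v : seq nat) : bool := all2 leq u v.

(* Duplicate-free, so that the [count] in [elevation] is a cardinality. *)
Definition extensions (delta : nat -> nat) (S : pred (seq nat)) (u : seq nat) :
    seq nat :=
  [seq a <- iota 0 (delta (size u).+1).+1 | S (rcons u a)].

Definition elevation (delta : nat -> nat) (S : pred (seq nat)) (u : seq nat) :
    seq nat :=
  [seq count (fun a => a < letter u i)
             (extensions delta S (take i.-1 u)) | i <- iota 1 (size u)].

(* Inverse of the elevation map on S(n). Off the image of S(n) its value is the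
   empty word, which is not of size n when n > 0 (and for n = 0 the empty word
   is the only word of S(n) and its own image). *)
Definition elevation_inv (delta : nat -> nat) (S : pred (seq nat)) (n : nat) :
    seq nat -> seq nat :=
  'pinv_(fun=> [::]) (graded S n) (elevation delta S).

(* Both A and B carry the order induced by cliff_le. *)
Definition poset_morphism (A B : set (seq nat)) (f : seq nat -> seq nat) :
    Prop :=
  (forall u, A u -> B (f u)) /\
  (forall u v, A u -> A v -> cliff_le u v -> cliff_le (f u) (f v)).

(* Main.v *)
Require Import Defs.
From mathcomp Require Import all_boot.
From mathcomp Require Import classical_sets functions.

Set Implicit Arguments.
Unset Strict Implicit.
Unset Printing Implicit Defensive.

(** Both elevation maps become transparent after taking prefix sums.

    On hills: a hill [u] can be extended exactly by the letters from its last
    letter up to the range bound, so the elevation of a hill is its sequence of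
    consecutive differences. It is therefore inverted by [prefix_sums], and its
    image consists of the words all of whose prefix sums stay below [delta].

    On canyons: let the letter [a] at position [i] cover the [a] unit cells
    [i], [i - 1], ..., [i - a + 1] of the integer line. The canyon condition
    says that the first cell left free by a letter, [i - a], is not covered by
    an earlier letter, and the elevation counts the cells that the new letter
    is the first to cover. So the prefix sums of the elevation of a canyon are
    the numbers of cells covered by its prefixes ([sumn_elevation_canyon]).

    Hence the map under study sends a canyon to the word whose [i]-th letter is
    the number of cells covered by the first [i] letters. Increasing the
    letters only enlarges the covered set, so this map preserves the order
    ([prefix_sums_canyon_le]). As [delta] is increasing, no letter reaches
    further left than cell [i - delta i + 1], so at most [delta i] cells are
    covered and the result is a hill ([cliff_prefix_sums_canyon]). *)

(** * Words extended by one letter *)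

Lemma iota1_rcons k : iota 1 k.+1 = rcons (iota 1 k) k.+1.
Proof. by rewrite -{1}(addn1 k) iotaD cats1 add1n. Qed.

Lemma letter_rcons u a i :
  0 < i <= size u -> letter (rcons u a) i = letter u i.
Proof. by case: i => // i /andP[_ le_i]; rewrite /letter nth_rcons le_i. Qed.

Lemma letter_rcons_last u a : letter (rcons u a) (size u).+1 = a.
Proof. by rewrite /letter nth_rcons ltnn eqxx. Qed.

Lemma cliff_rcons delta u a :
  cliff delta (rcons u a) = cliff delta u && (a <= delta (size u).+1).
Proof.
rewrite /cliff size_rcons iota1_rcons all_rcons letter_rcons_last andbC.
congr (_ && _); apply: eq_in_all => i.
by rewrite mem_iota add1n ltnS => /letter_rcons->.
Qed.

Lemma cliff_le_rcons u v a b :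
  cliff_le (rcons u a) (rcons v b) = cliff_le u v && (a <= b).
Proof.
rewrite /cliff_le; elim: u v => [|x u IHu] [|y v] //=; last by rewrite IHu andbA.
- by rewrite andbT.
- by case: v => [|z v]; rewrite /= ?andbF.
- by case: u {IHu} => [|z u]; rewrite /= ?andbF.
Qed.

Lemma cliff_le_size u v : cliff_le u v -> size u = size v.
Proof. by rewrite /cliff_le all2E => /andP[/eqP]. Qed.

Lemma cliff_le_letter u v i : cliff_le u v -> letter u i <= letter v i.
Proof.
rewrite /letter /cliff_le; elim: u v i.-1 => [|x u IHu] [|y v] // j /=.
by case/andP=> xy uv; case: j => //= j; apply: IHu.
Qed.

Lemma size_elevation delta S u : size (elevation delta S u) = size u.
Proof. by rewrite size_map size_iota. Qed.

(** Elevations are computed letter by letter, which reduces every statement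
    about them to an induction that appends one letter. *)
Lemma elevation_rcons delta S u a :
  elevation delta S (rcons u a) =
  rcons (elevation delta S u) (count (ltn^~ a) (extensions delta S u)).
Proof.
rewrite /elevation size_rcons iota1_rcons map_rcons letter_rcons_last /=.
congr rcons; last by rewrite -cats1 take_size_cat.
apply/eq_in_map => i; rewrite mem_iota add1n ltnS => i_in.
rewrite letter_rcons // -cats1 takel_cat //.
by case/andP: i_in => _; apply: leq_trans; rewrite leq_pred.
Qed.

Lemma count_iota_support (P : pred nat) N M :
    (forall c, P c -> c < N) -> (forall c, P c -> c < M) ->
  count P (iota 0 N) = count P (iota 0 M).
Proof.
wlog le_NM : N M / N <= M => [IH PN PM | PN _].
  by case/orP: (leq_total N M) => ?; [|symmetry]; apply: IH.
rewrite -(subnKC le_NM) iotaD count_cat add0n [X in _ + X](_ : _ = 0) ?addn0 //.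
apply/eqP; rewrite -leqn0 leqNgt -has_count; apply/hasPn => c.
by rewrite mem_iota => /andP[]; rewrite leqNgt => /negP le_Nc _; apply/negP=> /PN.
Qed.

Lemma count_ltn_iota a N : a <= N -> count (ltn^~ a) (iota 0 N) = a.
Proof.
move=> le_aN; rewrite (@count_iota_support _ N a) //.
  rewrite -[RHS](size_iota 0) -[RHS]count_predT.
  by apply: eq_in_count => c; rewrite mem_iota.
by move=> c /leq_trans; apply.
Qed.

(** * Hills and prefix sums *)

Definition prefix_sums (w : seq nat) : seq nat :=
  [seq sumn (take i w) | i <- iota 1 (size w)].

Lemma size_prefix_sums w : size (prefix_sums w) = size w.
Proof. by rewrite size_map size_iota. Qed.

Lemma prefix_sums_rcons w a :
  prefix_sums (rcons w a) = rcons (prefix_sums w) (sumn w + a).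
Proof.
rewrite /prefix_sums size_rcons iota1_rcons map_rcons.
rewrite -(size_rcons w a) take_size sumn_rcons; congr rcons.
apply/eq_in_map => i; rewrite mem_iota add1n ltnS => /andP[_ le_i].
by rewrite -cats1 takel_cat.
Qed.

Lemma last_prefix_sums w : last 0 (prefix_sums w) = sumn w.
Proof.
by case/lastP: w => // w a; rewrite prefix_sums_rcons last_rcons sumn_rcons.
Qed.

(** For the empty [u] the default [0] of [last] imposes no constraint on the
    first letter. *)
Lemma hill_rcons delta u a :
  hill delta (rcons u a) =
  [&& hill delta u, a <= delta (size u).+1 & last 0 u <= a].
Proof.
rewrite /hill cliff_rcons size_rcons /=.
case/lastP: u => [|u b]; first by rewrite /= !andbT.
rewrite last_rcons size_rcons iota1_rcons all_rcons -{3}(size_rcons u b).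
rewrite letter_rcons_last letter_rcons ?size_rcons ?leqnn // letter_rcons_last.
rewrite [X in _ && (_ && X)](_ : _ =
  all (fun i => letter (rcons u b) i <= letter (rcons u b) i.+1)
      (iota 1 (size u))); first by rewrite -!andbA andbC -!andbA; do !bool_congr.
apply: eq_in_all => i; rewrite mem_iota add1n ltnS => /andP[i0 le_i].
by rewrite !(@letter_rcons (rcons u b)) // size_rcons ?i0 ?ltnS // leqW.
Qed.

(** The admissible letters after [u] form an interval starting at the last
    letter of [u], so the elevation of a hill lists its increments. *)
Lemma count_extensions_hill delta u a :
    hill delta u -> a <= delta (size u).+1 ->
  count (ltn^~ a) (extensions delta (hill delta) u) = a - last 0 u.
Proof.
move=> hill_u le_a; rewrite /extensions count_filter.
set N := (delta _).+1; set l := last 0 u.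
rewrite (@eq_in_count _ _ (fun c => (l <= c) && (c < a))); last first.
  move=> c; rewrite mem_iota add0n ltnS => /andP[_ le_c] /=.
  by rewrite hill_rcons hill_u le_c andbC.
have [le_la|lt_al] := leqP l a; last first.
  rewrite (eqP (ltnW lt_al : a - l == 0)) (@eq_count _ _ pred0) ?count_pred0 //.
  move=> c /=; apply/negbTE/negP=> /andP[/leq_ltn_trans lt /lt].
  by rewrite ltnNge ltnW.
have -> : a - l = count (predC (ltn^~ l)) (iota 0 a).
  have := count_predC (ltn^~ l) (iota 0 a).
  by rewrite count_ltn_iota // size_iota => /(canRL (addKn _)).
rewrite (@count_iota_support _ N a); first last.
- by move=> c /andP[].
- by move=> c /andP[_ lt_ca]; rewrite /N ltnS ltnW // (leq_trans lt_ca).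
by apply: eq_in_count => c; rewrite mem_iota /= -leqNgt => ->; rewrite andbT.
Qed.

(** Summing the increments of a hill restores it; in particular the elevation
    map is injective on hills. *)
Lemma prefix_sums_elevation_hill delta u :
  hill delta u -> prefix_sums (elevation delta (hill delta) u) = u.
Proof.
elim/last_ind: u => // u a IHu; rewrite hill_rcons => /and3P[hill_u le_a le_la].
rewrite elevation_rcons count_extensions_hill // prefix_sums_rcons.
by rewrite -last_prefix_sums IHu // subnKC.
Qed.

(** Prefix sums are always weakly increasing, so the range bound is the only
    condition for a word to be the elevation of a hill. *)
Lemma elevation_hill_prefix_sums delta w :
    cliff delta (prefix_sums w) ->
  hill delta (prefix_sums w) /\ elevation delta (hill delta) (prefix_sums w) = w.
Proof.
elim/last_ind: w => // w a IHw; rewrite prefix_sums_rcons cliff_rcons.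
case/andP=> /IHw[hill_w elev_w] le_wa; rewrite hill_rcons hill_w le_wa.
rewrite last_prefix_sums leq_addr elevation_rcons elev_w.
by rewrite count_extensions_hill // last_prefix_sums addKn.
Qed.

Lemma elevation_inv_prefix_sums delta w :
    cliff delta (prefix_sums w) ->
  elevation_inv delta (hill delta) (size w) w = prefix_sums w.
Proof.
move=> /elevation_hill_prefix_sums[hill_w elev_w].
rewrite /elevation_inv -{2}elev_w pinvKV ?inE //; last first.
  by split; rewrite ?size_prefix_sums.
move=> u v; rewrite !inE => -[_ hu] [_ hv] euv.
by rewrite -(prefix_sums_elevation_hill hu) euv prefix_sums_elevation_hill.
Qed.

(** * Canyons and covered cells *)

(** Cells are numbered leftwards from the last position of the word, which
    keeps them in [nat] although letters may reach beyond position [1]: cell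
    [c] lies at position [size u - c], and the letter [j] places before the
    last one covers the cells from [j] on, as many as its value. *)
Definition covered (u : seq nat) (c : nat) : bool :=
  [exists j : 'I_(size u), (j <= c) && (c - j < letter u (size u - j))].

Lemma coveredP u c :
  reflect (exists j, [/\ j < size u, j <= c & c - j < letter u (size u - j)])
          (covered u c).
Proof.
apply: (iffP existsP) => [[j /andP[le_jc lt]]|[j [lt_j le_jc lt]]].
  by exists j.
by exists (Ordinal lt_j); rewrite /= le_jc.
Qed.

(** Appending a letter moves the origin of the numbering one cell to the
    right; this is the source of the shift by one. *)
Lemma covered_rcons u a c :
  covered (rcons u a) c = (c < a) || (0 < c) && covered u c.-1.
Proof.
apply/coveredP/idP => [[[|j] []]|]; rewrite size_rcons.
- by rewrite !subn0 letter_rcons_last => _ _ ->.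
- case: c => // c; rewrite !ltnS !subSS => lt_j le_jc lt.
  apply/orP; right; apply/coveredP; exists j; split=> //.
  by rewrite letter_rcons // subn_gt0 lt_j leq_subr in lt.
case/orP=> [lt_ca|/andP[]].
  by exists 0; rewrite !subn0 letter_rcons_last.
case: c => // c _ /coveredP[j [lt_j le_jc lt]]; exists j.+1.
by rewrite !subSS letter_rcons // subn_gt0 lt_j leq_subr.
Qed.

Lemma covered_le u v c : cliff_le u v -> covered u c -> covered v c.
Proof.
move=> uv /coveredP[j [lt_j le_jc lt]]; apply/coveredP; exists j.
rewrite -(cliff_le_size uv); split=> //.
exact: leq_trans (cliff_le_letter _ uv).
Qed.

(** The old cells are shifted by one when a letter is appended, and the bound
    grows by at least one because [delta] is increasing. *)
Lemma covered_bound delta u c :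
    increasing_range_map delta -> cliff delta u ->
  covered u c -> c < delta (size u).
Proof.
move=> inc; elim/last_ind: u c => [|u a IHu] c.
  by move=> _ /coveredP[j []].
rewrite cliff_rcons size_rcons covered_rcons => /andP[cliff_u le_a].
case/orP=> [/leq_trans|]; first exact.
case: c => //= c /[dup] /coveredP[j [lt_j _ _]] /(IHu _ cliff_u) lt_c.
exact: leq_ltn_trans lt_c (inc _ (leq_ltn_trans (leq0n _) lt_j)).
Qed.

(** The inequalities asked of a new letter [a] say that no earlier letter
    covers the cell just to the left of its own cells. In the numbering of [u]
    this cell is [a.-1]; for [a = 0] it is the new position itself, which no
    earlier letter reaches. *)
Lemma canyon_rcons delta u a :
  canyon delta (rcons u a) =
  [&& canyon delta u, a <= delta (size u).+1 & ~~ ((0 < a) && covered u a.-1)].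
Proof.
rewrite /canyon cliff_rcons size_rcons iota1_rcons all_rcons letter_rcons_last.
set A := all _ (iota 1 a).
rewrite [X in _ && (_ && X)](_ : _ = all (fun i => all (fun j =>
    (1 <= i - j) ==> (letter u (i - j) <= letter u i - j))
  (iota 1 (letter u i))) (iota 1 (size u))); last first.
  apply: eq_in_all => i; rewrite mem_iota add1n ltnS => /andP[i0 le_i].
  rewrite letter_rcons ?i0 //; apply: eq_in_all => j.
  rewrite mem_iota => /andP[j0 _]; apply: implyb_id2l => ij.
  by rewrite letter_rcons // ij (leq_trans (leq_subr _ _)).
have -> : A = ~~ ((0 < a) && covered u a.-1).
  apply/allP/idP => [ok|notcov j].
    case: a @A ok => // a A ok; apply/coveredP => -[j [lt_j le_ja]].
    have := ok j.+1; rewrite mem_iota add1n !ltnS le_ja subSS subn_gt0 lt_j.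
    move=> /(_ isT).
    by rewrite letter_rcons ?subn_gt0 ?lt_j ?leq_subr // subSS /= leqNgt => /negbTE->.
  rewrite mem_iota; case: j => // j; rewrite add1n !ltnS /= subSS => lt_ja.
  apply/implyP; rewrite subn_gt0 => lt_j.
  rewrite letter_rcons ?subn_gt0 ?lt_j ?leq_subr // leqNgt.
  apply: contra notcov => lt.
  case: a @A lt_ja lt => // a A; rewrite ltnS subSS => le_ja lt.
  by apply/coveredP; exists j.
by rewrite -!andbA; do !bool_congr.
Qed.

(** A value [b] below the new letter [a] is an admissible extension exactly
    when the cell numbered [b] from the new position is not yet covered, so each
    letter contributes to the elevation the number of cells that it is the
    first to cover. The bound [N] is free so that two canyons can be compared
    on the same range of cells. *)
Lemma sumn_elevation_canyon delta u N :
    canyon delta u -> (forall c, covered u c -> c < N) ->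
  sumn (elevation delta (canyon delta) u) = count (covered u) (iota 0 N).
Proof.
elim/last_ind: u N => [|u a IHu] N.
  move=> _ _; rewrite (@eq_count _ _ pred0) ?count_pred0 // => c.
  by apply/negbTE/negP => /coveredP[j []].
rewrite canyon_rcons => /and3P[can_u le_a _] bound.
rewrite elevation_rcons sumn_rcons (IHu N.-1) //; last first.
  by move=> c cov; rewrite ltn_predRL bound // covered_rcons cov orbT.
(* Cells covered by [u], renumbered from the end of [rcons u a], and cells
   that the letter [a] is the first to cover. *)
pose shifted c := (0 < c) && covered u c.-1.
pose fresh c := (c < a) && ~~ shifted c.
have -> : count (covered u) (iota 0 N.-1) = count shifted (iota 0 N).
  case: N {bound} => // N; rewrite /= add0n -[1]/(1 + 0) iotaDl count_map.
  exact: eq_count.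
rewrite count_filter [X in _ + X](@eq_in_count _ _ fresh); last first.
  move=> c; rewrite mem_iota add0n ltnS => /= le_c.
  by rewrite canyon_rcons can_u le_c.
rewrite (@count_iota_support fresh _ N); first last.
- by move=> c /andP[lt_ca _]; rewrite bound // covered_rcons lt_ca.
- by move=> c /andP[lt_ca _]; rewrite ltnS ltnW // (leq_trans lt_ca).
rewrite -count_predUI [X in _ + X](@eq_count _ _ pred0); last first.
  by move=> c /=; rewrite /fresh andbA andbAC andbN.
rewrite count_pred0 addn0; apply: eq_count => c /=.
rewrite covered_rcons -/(shifted c) /fresh.
by case: (shifted c); rewrite ?andbT ?orbT ?orbF.
Qed.

(** Only [delta (size u)] cells can be covered by [u], whence the bound on the
    last prefix sum; the others are those of shorter canyons. *)
Lemma cliff_prefix_sums_canyon delta u :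
    increasing_range_map delta -> canyon delta u ->
  cliff delta (prefix_sums (elevation delta (canyon delta) u)).
Proof.
move=> inc; elim/last_ind: u => // u a IHu can_ua.
have := can_ua; rewrite canyon_rcons => /and3P[/IHu cliff_u _ _].
have := can_ua; rewrite /canyon => /andP[cliff_ua _].
rewrite elevation_rcons prefix_sums_rcons cliff_rcons cliff_u /=.
rewrite size_prefix_sums size_elevation -sumn_rcons -elevation_rcons.
rewrite (sumn_elevation_canyon can_ua (fun c => covered_bound inc cliff_ua)).
by rewrite size_rcons (leq_trans (count_size _ _)) ?size_iota.
Qed.

(** Larger letters cover more cells. The elevations themselves need not be
    comparable: only their prefix sums are. *)
Lemma prefix_sums_canyon_le delta u v :
    increasing_range_map delta ->
    canyon delta u -> canyon delta v -> cliff_le u v ->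
  cliff_le (prefix_sums (elevation delta (canyon delta) u))
           (prefix_sums (elevation delta (canyon delta) v)).
Proof.
move=> inc; elim/last_ind: u v => [|u a IHu] v; first by case: v.
case/lastP: v => [|v b] can_ua can_vb le_uv.
  by have := cliff_le_size le_uv; rewrite size_rcons.
rewrite !elevation_rcons !prefix_sums_rcons cliff_le_rcons.
rewrite -!sumn_rcons -!elevation_rcons; apply/andP; split.
  move: can_ua can_vb le_uv; rewrite !canyon_rcons cliff_le_rcons.
  by move=> /and3P[? _ _] /and3P[? _ _] /andP[? _]; apply: IHu.
have /andP[cliff_vb _] := can_vb.
have bound_v c := @covered_bound _ _ c inc cliff_vb.
rewrite (sumn_elevation_canyon can_vb bound_v).
rewrite (sumn_elevation_canyon can_ua
  (fun c cov => bound_v c (covered_le le_uv cov))).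
by apply: sub_count => c; apply: covered_le.
Qed.

Theorem theorem2p4p2 (delta : nat -> nat) (n : nat) :
  increasing_range_map delta ->
  poset_morphism (graded (canyon delta) n) (graded (hill delta) n)
    (elevation_inv delta (hill delta) n \o elevation delta (canyon delta)).
Proof.
move=> inc.
have invE u : graded (canyon delta) n u ->
    elevation_inv delta (hill delta) n (elevation delta (canyon delta) u) =
    prefix_sums (elevation delta (canyon delta) u).
  case=> <- can_u; rewrite -[in LHS](size_elevation delta (canyon delta) u).
  exact/elevation_inv_prefix_sums/cliff_prefix_sums_canyon.
split=> [u can_u | u v can_u can_v le_uv] /=; rewrite !invE //.
  case: can_u => <- can_u; split; first by rewrite size_prefix_sums size_elevation.
  by case: (elevation_hill_prefix_sums (cliff_prefix_sums_canyon inc can_u)).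
by case: can_u can_v => _ can_u [_ can_v]; apply: prefix_sums_canyon_le.
Qed.
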